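(* Let $S$ be a complete semiring and let $\mathbf{C}$ be a small category. Let $Q_S(\mathbf{C})=\prod_{X,Y\in \operatorname{Ob}\mathbf{C}}\{f_{XY}:\operatorname{Hom}_{\mathbf{C}}(X,Y)\to S\}$, equipped with pointwise addition, the pointwise summation law, the zero family $0$, the convolution product $$(f\cdot g)_{XY}(\gamma)=\sum_{\beta\circ\alpha=\gamma} g_{ZY}(\beta)\cdot f_{XZ}(\alpha),$$ and the element $1$ which sends identity morphisms to $1\in S$ and all other morphisms to $0\in S$. Then $(Q_S(\mathbf{C}),+,\cdot,0,1)$ is a complete semiring.
   Context: A semiring $(S,+,\cdot,0,1)$ consists of a commutative monoid $(S,+,0)$ and a (not necessarily commutative) monoid $(S,\cdot,1)$ such that $\cdot$ distributes over $+$ from both sides and $0\cdot s=0=s\cdot 0$ for all $s$. A complete monoid is a commutative monoid $(M,+,0)$ with a summation law assigning to every family $(m_i)_{i\in I}$ of elements of $M$, indexed by an arbitrary set $I$, an element $\sum_{i\in I}m_i\in M$ such that $\sum_{i\in\varnothing}m_i=0$, $\sum_{i\in\{1\}}m_i=m_1$, $\sum_{i\in\{1,2\}}m_i=m_1+m_2$, and $\sum_{j\in J}\big(\sum_{i\in I_j}m_i\big)=\sum_{i\in I}m_i$ for every partition $I=\bigcup_{j\in J}I_j$. A semiring is complete if $(S,+,0,\sum)$ is a complete monoid and $\sum_i ss_i=s\sum_i s_i$, $\sum_i s_is=(\sum_i s_i)s$ for all families and all $s\in S$. The operations on $Q_S(\mathbf{C})$: for families $f=(f_{XY})$, $g=(g_{XY})$,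 $(f+g)_{XY}(\gamma)=f_{XY}(\gamma)+g_{XY}(\gamma)$; for a family $(f_j)_{j\in J}$, $(\sum_{j\in J} f_j)_{XY}(\gamma)=\sum_{j\in J}(f_j)_{XY}(\gamma)$ using the summation law of $S$. In the formula for $f\cdot g$, the sum (taken with the summation law of $S$) runs over all pairs $(\alpha,\beta)$ with $\alpha\in\operatorname{Hom}_{\mathbf{C}}(X,Z)$, $\beta\in\operatorname{Hom}_{\mathbf{C}}(Z,Y)$ for some object $Z$ and $\beta\circ\alpha=\gamma:X\to Y$. *)

(* Defs.v *)
From mathcomp Require Import all_boot all_algebra.
From mathcomp Require Import boolp classical_sets.

Set Implicit Arguments.
Unset Strict Implicit.
Unset Printing Implicit Defensive.

Import GRing.Theory.
Local Open Scope classical_set_scope.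
Local Open Scope ring_scope.

(* Index sets are types. The empty, one-point and two-point ones are void, unit
   and bool; invariance of sums under bijections of the index type follows from
   these cases and the partition axiom. Blocks of a partition may be empty,
   hence trivIset and a covering condition rather than
   classical_sets.partition, which demands inhabited blocks. *)
Record is_complete_monoid (M : nmodType)
    (bigsum : forall I : Type, (I -> M) -> M) : Prop := IsCompleteMonoid {
  bigsum_void : forall m : void -> M, bigsum void m = 0;
  bigsum_unit : forall m : unit -> M, bigsum unit m = m tt;
  bigsum_bool : forall m : bool -> M, bigsum bool m = m true + m false;
  bigsum_partition : forall (I J : Type) (B : J -> set I) (m : I -> M),
    trivIset [set: J] B -> \bigcup_(j in [set: J]) B j = [set: I] ->
    bigsum J (fun j => bigsum (B j) (fun i : B j => m (val i))) = bigsum I m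
}.

(* pzSemiRingType does not require 1 != 0. *)
Record is_complete_semiring (S : pzSemiRingType)
    (bigsum : forall I : Type, (I -> S) -> S) : Prop := IsCompleteSemiring {
  complete_semiring_monoid : is_complete_monoid bigsum;
  bigsum_mull : forall (I : Type) (s : S) (m : I -> S),
    bigsum I (fun i => s * m i) = s * bigsum I m;
  bigsum_mulr : forall (I : Type) (s : S) (m : I -> S),
    bigsum I (fun i => m i * s) = bigsum I m * s
}.

Record smallCategory := SmallCategory {
  Ob :> Type;
  Hom : Ob -> Ob -> Type;
  idm : forall X, Hom X X;
  comp : forall X Y Z, Hom Y Z -> Hom X Y -> Hom X Z;
  comp_idl : forall X Y (f : Hom X Y), comp (idm Y) f = f;
  comp_idr : forall X Y (f : Hom X Y), comp f (idm X) = f;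
  compA : forall X Y Z T (h : Hom Z T) (g : Hom Y Z) (f : Hom X Y),
    comp h (comp g f) = comp (comp h g) f
}.

Arguments Hom {s} X Y.
Arguments idm {s} X.
Arguments comp {s X Y Z} _ _.

Inductive is_identity (C : smallCategory) : forall X Y : C, Hom X Y -> Prop :=
  IsIdentity (X : C) : is_identity (idm X).

Record factorization (C : smallCategory) (X Y : C) (gamma : Hom X Y) :=
  Factorization {
    middle : C;
    alpha : Hom X middle;
    beta : Hom middle Y;
    factorizationE : comp beta alpha = gamma
  }.

Definition Q (S : Type) (C : smallCategory) : Type :=
  forall X Y : C, Hom X Y -> S.

Definition Qzero (S : pzSemiRingType) (C : smallCategory) : Q S C :=
  fun X Y gamma => 0.

Definition Qone (S : pzSemiRingType) (C : smallCategory) : Q S C :=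
  fun X Y gamma => if `[< is_identity gamma >] then 1 else 0.

Definition Qadd (S : pzSemiRingType) (C : smallCategory) (f g : Q S C) :
    Q S C :=
  fun X Y gamma => f X Y gamma + g X Y gamma.

Definition Qmul (S : pzSemiRingType)
    (bigsum : forall I : Type, (I -> S) -> S) (C : smallCategory)
    (f g : Q S C) : Q S C :=
  fun X Y gamma =>
    bigsum (factorization gamma) (fun p =>
      g (middle p) Y (beta p) * f X (middle p) (alpha p)).

Definition Qsum (S : pzSemiRingType)
    (bigsum : forall I : Type, (I -> S) -> S) (C : smallCategory)
    (J : Type) (f : J -> Q S C) : Q S C :=
  fun X Y gamma => bigsum J (fun j => f j X Y gamma).

Arguments Qzero S C : clear implicits.
Arguments Qone S C : clear implicits.
Arguments Qadd {S C} f g.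
Arguments Qmul {S} bigsum {C} f g.
Arguments Qsum {S} bigsum C J f.

(* Main.v *)
Require Import Defs.
From HB Require Import structures.
From mathcomp Require Import all_boot all_algebra.
From mathcomp Require Import boolp classical_sets.

(** Every semiring axiom for the convolution product is an identity between two
    iterated sums in [S], so the proof rests on a small calculus of unrestricted
    sums: reindexing along a bijection ([bigsum_bij]), the rule turning a double
    sum into a sum over pairs ([bigsum_sigT]), and the interchange of two sums
    ([bigsum_exchange]).  All three follow from the partition axiom, applied to
    the fibres of a map ([bigsum_fibre]).

    Binary addition and [0] are themselves sums, over [bool] and [void], so
    interchange gives at once that summation is additive and kills the zero
    family; this yields distributivity and annihilation.  The unit laws hold
    because a morphism [gamma] has exactly one factorization through each of the
    identities at its two ends, so only one term of the convolution survives.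
    For associativity, distributivity over arbitrary sums turns both bracketings
    into sums over iterated factorizations, and those that split the first
    factor again correspond to those that split the second one again: either
    way one has written [gamma] as a composite of three morphisms.  Completeness
    is pointwise, except for the distributivity of the product over sums, which
    is one more interchange. *)

Set Implicit Arguments.
Unset Strict Implicit.
Unset Printing Implicit Defensive.

Import GRing.Theory.
(* [Hom] and [comp] also name linear maps and composition of functions; the
   categorical meaning is the one wanted here. *)
Import Defs.
Local Open Scope classical_set_scope.
Local Open Scope ring_scope.

(** * Sums in a complete monoid *)

Section CompleteMonoid.

Variables (M : nmodType) (bigsum : forall I : Type, (I -> M) -> M).
Hypothesis hM : is_complete_monoid bigsum.

Lemma eq_bigsum (I : Type) (m n : I -> M) :
  m =1 n -> bigsum m = bigsum n.
Proof. by move=> /funext ->. Qed.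

Lemma bigsum_fibre (I J : Type) (f : I -> J) (m : I -> M) :
  bigsum (fun j => bigsum (fun i : f @^-1` [set j] => m (val i))) = bigsum m.
Proof.
apply: (bigsum_partition hM).
- by move=> j k _ _ [i [/= <- <-]].
- by apply/seteqP; split=> // i _; exists (f i).
Qed.

(** The partition axiom only produces sums over the subtype [setT], never over
    the type itself; the partition of [unit] into a single block bridges the
    two. *)
Lemma bigsum_setT (m : unit -> M) :
  bigsum (fun i : [set: unit] => m (val i)) = m tt.
Proof.
rewrite -(bigsum_unit hM m).
rewrite -(bigsum_partition hM (B := fun _ : unit => [set: unit])).
- by rewrite (bigsum_unit hM).
- by move=> [] [].
- by apply/seteqP; split=> // i _; exists tt.
Qed.

Lemma bigsum_singleton (I : Type) (i0 : I) (m : I -> M) :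
  (forall i, i = i0) -> bigsum m = m i0.
Proof.
move=> I1.
(* The one-point type indexes a partition of [unit] into one block. *)
have := @bigsum_partition _ _ hM unit I (fun _ => [set: unit]) (fun=> m i0).
rewrite (bigsum_unit hM) => <-.
- by apply: eq_bigsum => i; rewrite (bigsum_setT (fun=> m i0)) (I1 i).
- by move=> i j _ _ _; rewrite (I1 i) (I1 j).
- by apply/seteqP; split=> // i _; exists i0.
Qed.

(** The fibres of a bijection are one-point types. *)
Lemma bigsum_bij (I J : Type) (f : I -> J) (g : J -> I) (m : J -> M) :
  cancel f g -> cancel g f -> bigsum (fun i => m (f i)) = bigsum m.
Proof.
move=> fK gK; rewrite -(bigsum_fibre f); apply: eq_bigsum => j.
have gj : g j \in f @^-1` [set j] by apply/mem_set; exact: gK.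
rewrite (bigsum_singleton (i0 := exist _ (g j) gj)) /= ?gK// => -[i fi].
by apply: val_inj => /=; have /= <- := set_mem fi; rewrite fK.
Qed.

Lemma bigsum_sigT (I : Type) (K : I -> Type) (m : forall i, K i -> M) :
  bigsum (fun i => bigsum (m i)) =
  bigsum (fun p : {i : I & K i} => m (projT1 p) (projT2 p)).
Proof.
rewrite -(bigsum_fibre (@projT1 I K)); apply: eq_bigsum => i.
have inP (k : K i) : existT K i k \in @projT1 I K @^-1` [set i].
  exact/mem_set.
(* Transport along [outP] is the inverse of [inP]: the projection of [p] is only
   provably equal to [i]. *)
have outP (p : @projT1 I K @^-1` [set i]) : projT1 (val p) = i.
  exact: set_mem (valP p).
symmetry; pose f (p : @projT1 I K @^-1` [set i]) : K i :=
  eq_rect _ K (projT2 (val p)) _ (outP p).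
rewrite -(@bigsum_bij _ _ f (fun k => exist _ (existT K i k) (inP k))).
- apply: eq_bigsum => -[[j k] jk]; rewrite /f.
  by move: (outP _) => /= e; case: _ / e.
- move=> -[[j k] jk]; apply: val_inj => /=; rewrite /f.
  by move: (outP _) => /= e; case: _ / e.
- move=> k; rewrite /f; move: (outP _) => /= e.
  by rewrite (Prop_irrelevance e erefl).
Qed.

Lemma bigsum_exchange (I J : Type) (m : I -> J -> M) :
  bigsum (fun i => bigsum (fun j => m i j)) =
  bigsum (fun j => bigsum (fun i => m i j)).
Proof.
rewrite !bigsum_sigT; pose swap (A B : Type) (p : {_ : A & B}) : {_ : B & A} :=
  existT _ (projT2 p) (projT1 p).
by rewrite -(@bigsum_bij _ _ (@swap J I) (@swap I J)) // => -[].
Qed.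

(** Interchange with an empty sum. *)
Lemma bigsum0 (I : Type) : bigsum (fun _ : I => 0) = 0.
Proof.
have := @bigsum_exchange I void (fun _ => of_void M).
by rewrite !(bigsum_void hM).
Qed.

(** Interchange with a sum over two indices. *)
Lemma bigsumD (I : Type) (m n : I -> M) :
  bigsum (fun i => m i + n i) = bigsum m + bigsum n.
Proof.
have := @bigsum_exchange I bool (fun i b => if b then m i else n i).
rewrite (bigsum_bool hM) => <-.
by apply: eq_bigsum => i; rewrite (bigsum_bool hM).
Qed.

(** Splitting off the one-point fibre over [true] leaves a sum of zeros. *)
Lemma bigsum_only (I : Type) (i0 : I) (m : I -> M) :
  (forall i, i <> i0 -> m i = 0) -> bigsum m = m i0.
Proof.
move=> m0; pose f (i : I) := `[< i = i0 >].
rewrite -(bigsum_fibre f) (bigsum_bool hM).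
have i0P : i0 \in f @^-1` [set true] by apply/mem_set/asboolP.
rewrite (bigsum_singleton (i0 := exist _ i0 i0P)) /=; last first.
  by move=> [i fi]; apply: val_inj; exact/asboolP/(set_mem fi).
rewrite (_ : bigsum _ = 0) ?addr0// -[RHS](bigsum0 (f @^-1` [set false])).
by apply: eq_bigsum => -[i fi]; apply/m0/asboolPn/negbT; exact: (set_mem fi).
Qed.

End CompleteMonoid.

(** * Factorizations of a morphism *)

Section Factorizations.

Variable C : smallCategory.

Lemma eq_factorization (X Y Z : C) (gamma : Hom X Y) (a a' : Hom X Z)
    (b b' : Hom Z Y) (e : comp b a = gamma) (e' : comp b' a' = gamma) :
  a = a' -> b = b' -> Factorization e = Factorization e'.
Proof.
by move=> aa' bb'; subst a' b'; rewrite (Prop_irrelevance e e').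
Qed.

(** This and its mirror image leave a single nonzero term in a convolution with
    [Qone]. *)
Lemma is_identity_beta (X Y : C) (gamma : Hom X Y) (p : factorization gamma) :
  is_identity (beta p) -> p = Factorization (comp_idl gamma).
Proof.
case: p => Z a b e /= idb; case: idb gamma a e => W gamma a e.
by apply: eq_factorization => //; rewrite -e comp_idl.
Qed.

Lemma is_identity_alpha (X Y : C) (gamma : Hom X Y) (p : factorization gamma) :
  is_identity (alpha p) -> p = Factorization (comp_idr gamma).
Proof.
case: p => Z a b e /= ida; case: ida gamma b e => W gamma b e.
by apply: eq_factorization => //; rewrite -e comp_idr.
Qed.

Variables (X Y : C) (gamma : Hom X Y).

(** Both types present [gamma] as a composite of three morphisms.  They differ
    in which of the inner composites is kept as a component of the outer
    factorization, so passing from one to the other is recomposing. *)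
Definition split_alpha := {p : factorization gamma & factorization (alpha p)}.
Definition split_beta := {p : factorization gamma & factorization (beta p)}.

Lemma split_alpha_comp (t : split_alpha) :
  comp (comp (beta (projT1 t)) (beta (projT2 t))) (alpha (projT2 t)) = gamma.
Proof. by rewrite -compA !factorizationE. Qed.

Lemma split_beta_comp (t : split_beta) :
  comp (beta (projT2 t)) (comp (alpha (projT2 t)) (alpha (projT1 t))) = gamma.
Proof. by rewrite compA !factorizationE. Qed.

Definition split_alpha_beta (t : split_alpha) : split_beta :=
  existT (fun p => factorization (beta p))
    (Factorization (split_alpha_comp t)) (Factorization erefl).

Definition split_beta_alpha (t : split_beta) : split_alpha :=
  existT (fun p => factorization (alpha p))
    (Factorization (split_beta_comp t)) (Factorization erefl).

(** Once the inner equation is used to eliminate the composite that it defines,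
    only proofs of one and the same equation remain to be compared. *)
Lemma split_alpha_betaK : cancel split_alpha_beta split_beta_alpha.
Proof.
move=> [[Z a b e] [W /= a' b' e']]; case: a / e' e => e.
rewrite /split_beta_alpha /=; move: (split_beta_comp _) => /= e2.
by rewrite (Prop_irrelevance e2 e).
Qed.

Lemma split_beta_alphaK : cancel split_beta_alpha split_alpha_beta.
Proof.
move=> [[Z a b e] [W /= a' b' e']]; case: b / e' e => e.
rewrite /split_alpha_beta /=; move: (split_alpha_comp _) => /= e2.
by rewrite (Prop_irrelevance e2 e).
Qed.

End Factorizations.

(** * The convolution semiring *)

Section QNmodule.

Variables (S : pzSemiRingType) (C : smallCategory).

Lemma Q_ext (f g : Q S C) :
  (forall X Y (gamma : Hom X Y), f X Y gamma = g X Y gamma) -> f = g.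
Proof. by move=> fg; do 3 apply: functional_extensionality_dep => ?. Qed.

HB.instance Definition _ := gen_eqMixin (Q S C).
HB.instance Definition _ := gen_choiceMixin (Q S C).

Lemma QaddA : associative (@Qadd S C).
Proof. by move=> f g h; apply: Q_ext => X Y c; exact: addrA. Qed.

Lemma QaddC : commutative (@Qadd S C).
Proof. by move=> f g; apply: Q_ext => X Y c; exact: addrC. Qed.

Lemma Qadd0 : left_id (Qzero S C) (@Qadd S C).
Proof. by move=> f; apply: Q_ext => X Y c; exact: add0r. Qed.

HB.instance Definition _ := GRing.isNmodule.Build (Q S C) QaddA QaddC Qadd0.

End QNmodule.

Section QSemiring.

Variables (S : pzSemiRingType) (bigsum : forall I : Type, (I -> S) -> S).
Hypothesis hS : is_complete_semiring bigsum.
Variable C : smallCategory.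

Let hM := complete_semiring_monoid hS.

Local Notation mul := (@Qmul S bigsum C).

(** Both sides become sums over triples, in [split_beta] on the left and in
    [split_alpha] on the right. *)
Lemma QmulA : associative mul.
Proof.
move=> f g h; apply: Q_ext => X Y gamma; rewrite /Qmul.
under eq_bigsum do rewrite -(bigsum_mulr hS).
under [RHS]eq_bigsum do rewrite -(bigsum_mull hS).
rewrite !(bigsum_sigT hM) -(bigsum_bij hM _ (@split_alpha_betaK _ _ _ gamma)
  (@split_beta_alphaK _ _ _ gamma)) /=.
by apply: eq_bigsum => t; rewrite mulrA.
Qed.

Lemma Qmul1f : left_id (Qone S C) mul.
Proof.
move=> f; apply: Q_ext => X Y gamma; rewrite /Qmul /Qone.
rewrite (bigsum_only hM (i0 := Factorization (comp_idr gamma))) /=.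
- by rewrite asboolT ?mulr1//; constructor.
- by move=> p pP; rewrite asboolF ?mulr0// => /is_identity_alpha.
Qed.

Lemma Qmulf1 : right_id (Qone S C) mul.
Proof.
move=> f; apply: Q_ext => X Y gamma; rewrite /Qmul /Qone.
rewrite (bigsum_only hM (i0 := Factorization (comp_idl gamma))) /=.
- by rewrite asboolT ?mul1r//; constructor.
- by move=> p pP; rewrite asboolF ?mul0r// => /is_identity_beta.
Qed.

Lemma QmulDl : left_distributive mul (@Qadd S C).
Proof.
move=> f g h; apply: Q_ext => X Y gamma; rewrite /Qmul /Qadd.
by rewrite -(bigsumD hM); apply: eq_bigsum => p; rewrite mulrDr.
Qed.

Lemma QmulDr : right_distributive mul (@Qadd S C).
Proof.
move=> f g h; apply: Q_ext => X Y gamma; rewrite /Qmul /Qadd.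
by rewrite -(bigsumD hM); apply: eq_bigsum => p; rewrite mulrDl.
Qed.

Lemma Qmul0f : left_zero (Qzero S C) mul.
Proof.
move=> f; apply: Q_ext => X Y gamma; rewrite /Qmul /Qzero.
by under eq_bigsum do rewrite mulr0; rewrite (bigsum0 hM).
Qed.

Lemma Qmulf0 : right_zero (Qzero S C) mul.
Proof.
move=> f; apply: Q_ext => X Y gamma; rewrite /Qmul /Qzero.
by under eq_bigsum do rewrite mul0r; rewrite (bigsum0 hM).
Qed.

(** The product on [Q S C] depends on the summation law and its axioms exist
    only under [hS], which the type [Q S C] does not mention; the instance is
    therefore attached to a synonym that records [hS]. *)
Definition convolution_ring of is_complete_semiring bigsum : Type := Q S C.

HB.instance Definition _ := GRing.Nmodule.on (convolution_ring hS).
HB.instance Definition _ :=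
  GRing.Nmodule_isPzSemiRing.Build (convolution_ring hS)
    QmulA Qmul1f Qmulf1 QmulDl QmulDr Qmul0f Qmulf0.

Lemma Qsum_complete_monoid : @is_complete_monoid (Q S C) (Qsum bigsum C).
Proof.
split.
- by move=> m; apply: Q_ext => X Y c; exact: (bigsum_void hM).
- by move=> m; apply: Q_ext => X Y c; exact: (bigsum_unit hM).
- by move=> m; apply: Q_ext => X Y c; exact: (bigsum_bool hM).
- move=> I J B m tB cB; apply: Q_ext => X Y c.
  exact: (bigsum_partition hM (fun i => m i X Y c)).
Qed.

Lemma Qsum_mull (I : Type) (s : Q S C) (m : I -> Q S C) :
  Qsum bigsum C I (fun i => mul s (m i)) = mul s (Qsum bigsum C I m).
Proof.
apply: Q_ext => X Y gamma; rewrite /Qsum /Qmul (bigsum_exchange hM).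
by apply: eq_bigsum => p; rewrite (bigsum_mulr hS).
Qed.

Lemma Qsum_mulr (I : Type) (s : Q S C) (m : I -> Q S C) :
  Qsum bigsum C I (fun i => mul (m i) s) = mul (Qsum bigsum C I m) s.
Proof.
apply: Q_ext => X Y gamma; rewrite /Qsum /Qmul (bigsum_exchange hM).
by apply: eq_bigsum => p; rewrite (bigsum_mull hS).
Qed.

End QSemiring.

Theorem proposition4p2 (S : pzSemiRingType)
    (bigsum : forall I : Type, (I -> S) -> S)
    (hS : is_complete_semiring bigsum) (C : smallCategory) :
  exists K : GRing.PzSemiRing (Q S C),
    let R : pzSemiRingType := GRing.PzSemiRing.Pack K in
    [/\ (0 : R) = Qzero S C,
        (1 : R) = Qone S C,
        (forall f g : R, f + g = Qadd f g),
        (forall f g : R, f * g = Qmul bigsum f g) &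
        @is_complete_semiring R (Qsum bigsum C)].
Proof.
exists (GRing.PzSemiRing.class (convolution_ring C hS : pzSemiRingType)).
split=> //; split.
- exact: (Qsum_complete_monoid hS C).
- exact: (Qsum_mull hS).
- exact: (Qsum_mulr hS).
Qed.
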